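(* Let $\mathcal G = (g_i)_{i=0}^{\infty}$ be a $\mathcal G$-adic sequence with quotients $d_i = g_{i+1}/g_i$. Let $I$ be an infinite set of nonnegative integers, and, for each $i \in I$, let $U_i$ be a nonempty proper subset of $[0,d_i-1]$. Let $A$ be the set of positive integers $n$ whose $\mathcal G$-adic representation $n = \sum_{i=0}^k c_i g_i$ (with $c_k \neq 0$) satisfies the missing digits condition $$c_i \in [0,d_i-1] \setminus U_i \quad \text{for all } i \in I \cap [0,k].$$ If the set $A$ is infinite and if $$\sum_{i \in I} \frac{|U_i|}{d_i} < \infty,$$ then the sequence $\mathcal G$ has unbounded quotients and the harmonic series $\sum_{a \in A} 1/a$ diverges.
   Context: A $\mathcal G$-adic sequence is a strictly increasing sequence of positive integers $\mathcal G = (g_i)_{i=0}^{\infty}$ such that $g_0 = 1$ and $g_i$ divides $g_{i+1}$ for all $i \geq 0$. Its quotients are the integers $d_i = g_{i+1}/g_i \geq 2$; $\mathcal G$ has unbounded quotients if $\limsup_{i\to\infty} d_i = \infty$. Every positive integer $n$ has a unique representation $n = \sum_{i=0}^{k} c_i g_i$ with $c_i \in \{0,1,\ldots,d_i-1\}$ for all $i \in \{0,1,\ldots,k\}$ and $c_k \neq 0$; this is called the $\mathcal G$-adic representation of $n$ (here $k$ is determined by $g_k \leq n \leq g_{k+1}-1$). For integers $a,b$, $[a,b] = \{n \in \mathbf Z : a \leq n \leq b\}$ denotes the interval of integers. *)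

(* Defs.v *)
(* MathComp / MathComp-Analysis *)
From mathcomp Require Import all_boot all_order all_algebra finmap.
From mathcomp Require Import all_classical all_reals all_analysis.

Set Implicit Arguments.
Unset Strict Implicit.
Unset Printing Implicit Defensive.

Import Order.TTheory GRing.Theory Num.Theory.
Local Open Scope classical_set_scope.
Local Open Scope nat_scope.

Definition adic_sequence (g : nat -> nat) : Prop :=
  [/\ g 0 = 1, (forall i, 0 < g i), {homo g : i j / i < j}
    & forall i, g i %| g i.+1].

Definition adic_quotient (g : nat -> nat) (i : nat) : nat := g i.+1 %/ g i.

Definition unbounded_quotients (R : realType) (g : nat -> nat) : Prop :=
  limn_esup (fun i => ((adic_quotient g i)%:R : R)%:E) = +oo%E.

(* Only the digits [c 0], ..., [c k] matter; [c] is unconstrained above [k]. *)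
Definition adic_representation (g : nat -> nat) (n k : nat) (c : nat -> nat)
    : Prop :=
  [/\ n = \sum_(i < k.+1) c i * g i,
      (forall i, i <= k -> c i < adic_quotient g i)
    & c k != 0].

(* Positive integers have exactly one representation up to the values of [c]
   above [k], so the existential means "the representation of n satisfies". *)
Definition missing_digits (g : nat -> nat) (I : set nat) (U : nat -> {fset nat})
    : set nat :=
  [set n | 0 < n /\ exists k c, adic_representation g n k c /\
     forall i, I i -> i <= k -> (`I_(adic_quotient g i) `\` [set` U i]) (c i)].

(* Main.v *)
Require Import Defs.
From mathcomp Require Import all_boot all_order all_algebra finmap.
From mathcomp Require Import all_classical all_reals all_analysis.
From mathcomp Require Import zify ring lra.

(** Write [d i] for the quotients, [r i] for the proportion of digits excluded
at position [i] (zero off [I]), and [P k] for the proportion of allowed digit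
strings among all strings on the positions below [k], that is, among the
integers below [g k] padded with leading zeros.

Unbounded quotients.  A nonempty [U i] gives [1 / d i <= r i], and [r i] tends
to zero because the [r i] are summable; so [d i] tends to infinity along the
infinite set [I].

Divergence.  The digits are independent, so [P k.+1 = (1 - r k) * P k]
([allowed_densityS]).  Every factor is positive because [U i] is proper, and
[\prod (1 - r i) >= 1 - \sum r i] on a tail where the sum is below [1/4]
([allowed_density_ge]); hence [P] stays above a positive constant.

An integer between [g k] and [g k.+1] belongs to the set as soon as its
[k.+1] lowest digits are allowed.  There are at least
[P k.+1 * g k.+1 - P k * g k] such integers, because an allowed string on
[k.+1] positions is either one of these or an allowed string on [k] positions
preceded by a zero.  Each has reciprocal at least [1 / g k.+1], so the block
contributes at least [P k.+1 - P k / d k >= (1/2 - r k) * P k] to the harmonic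
sum ([harmonic_sum_block]).  For large [k] this exceeds a fixed positive
constant, so the partial sums up to [g k] grow at least linearly in [k]
([harmonic_sum_growth]). *)

Import Order.TTheory GRing.Theory Num.Theory.
Local Open Scope classical_set_scope.
Local Open Scope nat_scope.

(** * Digits and the counting of allowed strings *)

Definition adic_digit (g : nat -> nat) (i n : nat) : nat :=
  n %% g i.+1 %/ g i.

Definition digit_allowed (I : set nat) (U : nat -> {fset nat}) (i c : nat)
    : bool := (i \in I) ==> (c \notin U i).

(** Leading zeros count as digits here: for [n] below [g k] all [k] positions are
tested, including those above the top digit of [n].  This makes the positions
independent of each other, which membership in [missing_digits] does not. *)
Definition digits_allowed (g : nat -> nat) (I : set nat)
    (U : nat -> {fset nat}) (k n : nat) : bool :=
  all (fun i => digit_allowed I U i (adic_digit g i n)) (iota 0 k).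

Definition allowed_count (g : nat -> nat) (I : set nat)
    (U : nat -> {fset nat}) (k : nat) : nat :=
  \sum_(0 <= n < g k) digits_allowed g I U k n.

Definition excluded_count (I : set nat) (U : nat -> {fset nat}) (i : nat)
    : nat := if i \in I then #|` U i| else 0.

Section Adic.
Context (g : nat -> nat) (adic_g : adic_sequence g).

Lemma adic_pos i : 0 < g i.
Proof. by case: adic_g. Qed.

Lemma adic_succE i : g i.+1 = adic_quotient g i * g i.
Proof. by case: adic_g => _ _ _ gdvd; rewrite divnK. Qed.

Lemma adic_quotient_gt1 i : 1 < adic_quotient g i.
Proof.
have : g i < g i.+1 by case: adic_g => _ _ gmono _; exact: gmono.
by rewrite adic_succE; have := adic_pos i; nia.
Qed.

Lemma adic_dvd i j : i <= j -> g i %| g j.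
Proof.
move=> /subnK <-; elim: (j - i) => [|m IH]; first exact: dvdnn.
by rewrite addSn adic_succE dvdn_mull.
Qed.

Lemma adic_digit_lt i n : adic_digit g i n < adic_quotient g i.
Proof. by rewrite ltn_divLR ?adic_pos// -adic_succE ltn_mod adic_pos. Qed.

(** Induction on [k]: the remainder of [n] by [g k.+1] splits into its quotient by
[g k], which is the digit at [k], and the remainder of [n] by [g k]. *)
Lemma sum_adic_digit k n : \sum_(i < k) adic_digit g i n * g i = n %% g k.
Proof.
elim: k => [|k IH]; first by case: adic_g => -> _ _ _; rewrite big_ord0 modn1.
rewrite big_ord_recr/= IH -(modn_dvdm n (adic_dvd _ _ (leqnSn k))) addnC.
by rewrite -divn_eq.
Qed.

Lemma adic_digitMD k c b i : i < k ->
  adic_digit g i (c * g k + b) = adic_digit g i b.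
Proof.
move=> ik; rewrite /adic_digit.
by have /dvdnP[q ->] := adic_dvd _ _ ik; rewrite mulnA modnMDl.
Qed.

Lemma adic_digit_top k c b : c < adic_quotient g k -> b < g k ->
  adic_digit g k (c * g k + b) = c.
Proof.
move=> cd bg; rewrite /adic_digit modn_small; last by rewrite adic_succE; nia.
by rewrite divnMDl ?adic_pos// divn_small// addn0.
Qed.

Context (I : set nat) (U : nat -> {fset nat}).

Lemma digits_allowedS k n :
  digits_allowed g I U k.+1 n =
  digits_allowed g I U k n && digit_allowed I U k (adic_digit g k n).
Proof. by rewrite /digits_allowed -addn1 iotaD all_cat/= andbT. Qed.

(** In the block from [g k] to [g k.+1] the digit at [k] is the leading one, so no
leading zero is tested and the two notions of admissibility agree. *)
Lemma digits_allowed_missing k n : g k <= n < g k.+1 ->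
  digits_allowed g I U k.+1 n -> missing_digits g I U n.
Proof.
move=> /andP[gn ng] /allP alw; split; first exact: leq_trans (adic_pos k) gn.
exists k, (fun i => adic_digit g i n); split.
  split; first by rewrite sum_adic_digit modn_small.
    by move=> i _; exact: adic_digit_lt.
  by rewrite /adic_digit modn_small// -lt0n divn_gt0 ?adic_pos.
move=> i Ii ik; split; first exact: adic_digit_lt.
have := alw i; rewrite mem_iota/= add0n ltnS ik => /(_ isT).
by rewrite /digit_allowed mem_set//= => /negP.
Qed.

Context (U_proper : forall i, I i -> [set` U i] `<` `I_(adic_quotient g i)).

Lemma excluded_count_lt i : excluded_count I U i < adic_quotient g i.
Proof.
rewrite /excluded_count; case: ifPn => [/set_mem/U_proper[sub nsub]|_]; last first.
  exact: ltnW (adic_quotient_gt1 i).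
rewrite ltnNge; apply/negP => le; apply: nsub => c /= cd.
have us : {subset enum_fset (U i) <= iota 0 (adic_quotient g i)}.
  by move=> x /sub /=; rewrite mem_iota.
have := uniq_min_size (fset_uniq (U i)) us; rewrite size_iota => /(_ le) [_ e].
by rewrite e mem_iota.
Qed.

Lemma sum_digit_allowed i :
  \sum_(0 <= c < adic_quotient g i) digit_allowed I U i c =
  adic_quotient g i - excluded_count I U i.
Proof.
rewrite /digit_allowed /excluded_count.
case: ifPn => [iI|_]; last by rewrite /= sum_nat_const_nat muln1.
have sub := (U_proper _ (set_mem iI)).1.
under eq_bigr do rewrite implyTb.
have -> : \sum_(0 <= c < adic_quotient g i) (c \notin U i : nat) =
          count (predC (fun c => c \in U i)) (iota 0 (adic_quotient g i)).
  rewrite -sum1_count [RHS]big_mkcond /index_iota subn0.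
  by apply: eq_bigr => c _ /=; case: (c \in U i).
rewrite -[X in X - _](size_iota 0) -(count_predC (fun c => c \in U i) (iota _ _)).
suff -> : count (fun c => c \in U i) (iota 0 (adic_quotient g i)) = #|` U i|.
  by rewrite addKn.
rewrite -size_filter; apply: perm_size; apply: uniq_perm.
- exact/filter_uniq/iota_uniq.
- exact: fset_uniq.
move=> c; rewrite mem_filter mem_iota add0n leq0n.
by case: (boolP (c \in U i)) => //= /sub /= ->.
Qed.

(** Each integer below [g k.+1] is [c * g k + b] for one digit [c] and one [b]
below [g k]; it is allowed exactly when both [c] and [b] are, so the count is a
product. *)
Lemma allowed_countS k :
  allowed_count g I U k.+1 =
  (adic_quotient g k - excluded_count I U k) * allowed_count g I U k.
Proof.
rewrite -sum_digit_allowed /allowed_count adic_succE big_nat_mul big_distrl/=.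
apply: eq_big_nat => c /andP[_ cd].
rewrite -{1}[c * g k]add0n big_addn mulSn addnK big_distrr/=.
apply: eq_big_nat => b /andP[_ bg]; rewrite digits_allowedS addnC.
rewrite adic_digit_top// mulnb andbC; congr (_ && _ : nat).
by apply: eq_in_all => i; rewrite mem_iota add0n => /= ik; rewrite adic_digitMD.
Qed.

Lemma allowed_count_gt0 k : 0 < allowed_count g I U k.
Proof.
elim: k => [|k IH].
  by rewrite /allowed_count; case: adic_g => -> _ _ _; rewrite big_nat1.
by rewrite allowed_countS muln_gt0 IH subn_gt0 excluded_count_lt.
Qed.

(** The allowed strings on [k.+1] positions that lie outside the block have a zero
at [k], and so are already counted on [k] positions.  This bound holds whether
or not zero is an allowed digit at [k]. *)
Lemma allowed_block_count k :
  allowed_count g I U k.+1 - allowed_count g I U k <=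
  \sum_(g k <= n < g k.+1) (n \in missing_digits g I U).
Proof.
rewrite leq_subLR {1}/allowed_count (@big_cat_nat _ _ _ (g k))//=; last first.
  by apply: dvdn_leq (adic_dvd _ _ (leqnSn k)); exact: adic_pos.
apply: leq_add.
  apply: leq_sum => n _; rewrite digits_allowedS.
  by case: digits_allowed => //=; case: digit_allowed.
rewrite big_nat [leqRHS]big_nat; apply: leq_sum => n ngk.
case: (boolP (digits_allowed _ _ _ _ _)) => // /(digits_allowed_missing _ _ ngk).
by move=> /mem_set ->.
Qed.

End Adic.

Local Open Scope ring_scope.

(** * Tails of summable families and unbounded quotients *)

Lemma summable_tail_lt (R : realType) (I : set nat) (a : nat -> R) :
  (forall i, 0 <= a i) -> (\esum_(i in I) (a i)%:E < +oo)%E ->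
  forall e : R, 0 < e ->
    exists N, forall m, \sum_(N <= i < m | i \in I) a i < e.
Proof.
move=> a0 sa e e0.
have aE0 i : i \in I -> (0 <= (a i)%:E)%E by rewrite lee_fin.
rewrite -[I]set_mem_set -nneseries_esum// in sa.
have tail0 := nneseries_tail_cvg sa aE0.
have /tail0[N _ /(_ N (leqnn N)) /= tailN] :
    nbhs 0%E [set x : \bar R | (x < e%:E)%E].
  apply: open_nbhs_nbhs; split; first exact: open_ereal_lt_ereal.
  by rewrite /= lte_fin.
exists N => m; rewrite -lte_fin -sumEFin; apply: le_lt_trans tailN.
by apply: nneseries_lim_ge => i _; exact: aE0.
Qed.

Lemma unbounded_quotients_frequently_large (R : realType) (g : nat -> nat) :
  (forall (M : R) n, exists2 i, (n <= i)%N & M <= (adic_quotient g i)%:R) ->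
  unbounded_quotients R g.
Proof.
move=> large; rewrite /unbounded_quotients limn_esup_lim.
rewrite (_ : esups _ = cst +oo%E); first exact: lim_cst.
apply/funext => n /=; apply: eq_infty => M.
have [i ni Mi] := large M n.
apply: (@le_trans _ _ ((adic_quotient g i)%:R : R)%:E); first by rewrite lee_fin.
by apply: ereal_sup_ubound; exists i.
Qed.

(** * Density of the allowed strings and growth of the harmonic sum *)

Section Density.
Context (R : realType) (g : nat -> nat) (I : set nat) (U : nat -> {fset nat}).
Context (adic_g : adic_sequence g).
Context (U_proper : forall i, I i -> [set` U i] `<` `I_(adic_quotient g i)).

Definition excluded_ratio i : R :=
  (excluded_count I U i)%:R / (adic_quotient g i)%:R.

Definition allowed_density k : R := (allowed_count g I U k)%:R / (g k)%:R.

Lemma quotient_gt0R i : 0 < (adic_quotient g i)%:R :> R.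
Proof. by rewrite ltr0n; apply: ltnW; exact: adic_quotient_gt1. Qed.

Lemma adic_gt0R i : 0 < (g i)%:R :> R.
Proof. by rewrite ltr0n; exact: adic_pos. Qed.

Lemma excluded_ratio_ge0 i : 0 <= excluded_ratio i.
Proof. by rewrite divr_ge0. Qed.

Lemma excluded_ratio_lt1 i : excluded_ratio i < 1.
Proof.
by rewrite ltr_pdivrMr ?quotient_gt0R// mul1r ltr_nat; exact: excluded_count_lt.
Qed.

Lemma quotient_inv_le_excluded_ratio i :
  I i -> [set` U i] !=set0 -> (adic_quotient g i)%:R^-1 <= excluded_ratio i.
Proof.
move=> Ii [u uU]; rewrite /excluded_ratio /excluded_count mem_set//.
rewrite ler_peMl ?invr_ge0 ?ler0n// ler1n cardfs_gt0.
by apply/fset0Pn; exists u.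
Qed.

Lemma allowed_density_gt0 k : 0 < allowed_density k.
Proof. by rewrite divr_gt0 ?adic_gt0R// ltr0n; exact: allowed_count_gt0. Qed.

Lemma allowed_densityS k :
  allowed_density k.+1 = (1 - excluded_ratio k) * allowed_density k.
Proof.
rewrite /allowed_density allowed_countS// adic_succE// !natrM natrB; last first.
  by apply: ltnW; exact: excluded_count_lt.
rewrite /excluded_ratio; have := quotient_gt0R k; have := adic_gt0R k.
by move=> *; field; rewrite !gt_eqF.
Qed.

(** The union bound [\prod (1 - r i) >= 1 - \sum r i], with the product
of the factors written as a ratio of densities. *)
Lemma allowed_density_ge N m :
  (1 - \sum_(N <= i < N + m) excluded_ratio i) * allowed_density N <=
  allowed_density (N + m).
Proof.
elim: m => [|m IH]; first by rewrite addn0 big_geq// subr0 mul1r.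
rewrite addnS allowed_densityS big_nat_recr ?leq_addr//=.
set s := \sum_(_ <= _ < _) _ in IH *; set r := excluded_ratio _.
have r0 : 0 <= r by exact: excluded_ratio_ge0.
have r1 : r < 1 by exact: excluded_ratio_lt1.
have s0 : 0 <= s by apply: sumr_ge0 => i _; exact: excluded_ratio_ge0.
have P0 := allowed_density_gt0 N.
apply: (@le_trans _ _ ((1 - r) * ((1 - s) * allowed_density N))).
  rewrite mulrA ler_wpM2r ?(ltW P0)//; nra.
by rewrite ler_wpM2l// subr_ge0 ltW.
Qed.

Definition harmonic_sum n : R :=
  \sum_(0 <= a < n | a \in missing_digits g I U) a%:R^-1.

(** Counting gives [P k.+1 - P k / d k], and [d k >= 2]; the factor [1/2] thus
accounts for the strings with a zero at position [k]. *)
Lemma harmonic_sum_block k :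
  (2^-1 - excluded_ratio k) * allowed_density k <=
  harmonic_sum (g k.+1) - harmonic_sum (g k).
Proof.
have gg : (g k <= g k.+1)%N.
  by case: adic_g => _ _ gmono _; exact/ltnW/gmono.
rewrite /harmonic_sum (big_cat_nat (leq0n _) gg)/= addrAC subrr add0r.
apply: (@le_trans _ _ ((\sum_(g k <= n < g k.+1)
    (n \in missing_digits g I U))%N%:R / (g k.+1)%:R)); last first.
  rewrite natr_sum mulr_suml [leRHS]big_mkcond [leLHS]big_nat [leRHS]big_nat.
  apply: ler_sum => n /andP[gn ng]; case: ifPn => _; last by rewrite mul0r.
  have n0 : (0 < n)%N by exact: leq_trans (adic_pos g adic_g k) gn.
  rewrite mul1r lef_pV2 ?posrE ?ltr0n ?(adic_pos g)//.
  by rewrite ler_nat ltnW.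
have := allowed_block_count g adic_g I U k.
rewrite leq_subLR -(ler_nat R) natrD.
set c := (\sum_(_ <= _ < _) _)%N => cge.
apply: (@le_trans _ _ (allowed_density k.+1 - 2^-1 * allowed_density k)).
  by rewrite allowed_densityS; lra.
have g0 := adic_gt0R k.+1.
rewrite ler_pdivlMr// mulrBl divfK ?gt_eqF//.
suff : (allowed_count g I U k)%:R <=
   2^-1 * allowed_density k * (g k.+1)%:R by lra.
rewrite (adic_succE g)// natrM /allowed_density mulrACA -mulrA.
rewrite [X in 2^-1 * X](_ : _ = (adic_quotient g k)%:R * (allowed_count g I U k)%:R).
  have : 2 <= (adic_quotient g k)%:R :> R by rewrite ler_nat adic_quotient_gt1.
  have : 0 <= (allowed_count g I U k)%:R :> R by [].
  nra.
by congr (_ * _); rewrite divfK ?gt_eqF ?adic_gt0R.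
Qed.

(** With the tail of the [r i] below [1/4], the density stays above [3/4 * P N] and
each block contributes at least [(1/2 - 1/4) * (3/4 * P N) = 3/16 * P N],
which is more than [P N / 8]. *)
Lemma harmonic_sum_growth N m :
  (forall n, \sum_(N <= i < n) excluded_ratio i < 4^-1) ->
  m%:R * (8^-1 * allowed_density N) <= harmonic_sum (g (N + m)%N).
Proof.
move=> tailN; elim: m => [|m IH].
  by rewrite mul0r sumr_ge0// => a _; rewrite invr_ge0.
have block := harmonic_sum_block (N + m).
have dens := allowed_density_ge N m.
rewrite addnS -natr1 mulrDl mul1r.
have s4 := tailN (N + m)%N.
have s4' := tailN (N + m).+1.
rewrite big_nat_recr ?leq_addr//= in s4'.
have s0 : 0 <= \sum_(N <= i < N + m) excluded_ratio i.
  by apply: sumr_ge0 => i _; exact: excluded_ratio_ge0.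
have r0 := excluded_ratio_ge0 (N + m).
have P0 := allowed_density_gt0 N.
move: (excluded_ratio _) (\sum_(_ <= _ < _) _) => r s in s4 s4' s0 r0 block dens.
move: (allowed_density (N + m)%N) => p in block dens *.
have p34 : 3 / 4 * allowed_density N <= p by nra.
have : 8^-1 * allowed_density N <= (2^-1 - r) * p by nra.
lra.
Qed.

End Density.

Theorem theorem2 (R : realType) (g : nat -> nat) (I : set nat)
    (U : nat -> {fset nat})
    (adic_g : adic_sequence g)
    (I_infinite : infinite_set I)
    (U_nonempty : forall i, I i -> [set` U i] !=set0)
    (U_proper : forall i, I i -> [set` U i] `<` `I_(adic_quotient g i))
    (A_infinite : infinite_set (missing_digits g I U))
    (U_summable :
      (\esum_(i in I) ((#|` U i|)%:R / (adic_quotient g i)%:R : R)%:E < +oo)%E) :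
  unbounded_quotients R g /\
  (\esum_(a in missing_digits g I U) ((a%:R : R)^-1)%:E = +oo)%E.
Proof.
have ratio0 i : 0 <= (#|` U i|)%:R / (adic_quotient g i)%:R :> R.
  by rewrite divr_ge0.
have tail := summable_tail_lt R I _ ratio0 U_summable.
have ratio_sum N m : \sum_(N <= i < m | i \in I)
    (#|` U i|)%:R / (adic_quotient g i)%:R =
    \sum_(N <= i < m) excluded_ratio R g I U i.
  rewrite big_mkcond; apply: eq_bigr => i _; rewrite /excluded_ratio.
  by rewrite /excluded_count; case: ifP => // _; rewrite mul0r.
have {}tail e : 0 < e -> exists N,
    forall m, \sum_(N <= i < m) excluded_ratio R g I U i < e.
  by move=> /tail[N tailN]; exists N => m; rewrite -ratio_sum.
have small e : 0 < e -> exists N,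
    forall i, (N <= i)%N -> excluded_ratio R g I U i < e.
  move=> /tail[N tailN]; exists N => i Ni; apply: le_lt_trans (tailN i.+1).
  rewrite big_nat_recr//= lerDr; apply: sumr_ge0 => j _.
  exact: excluded_ratio_ge0.
split.
  apply: unbounded_quotients_frequently_large => M n.
  have M0 : 0 < (`|M| + 1)^-1 by rewrite invr_gt0 ltr_wpDl.
  have [N smallN] := small _ M0.
  have [i [Ii /negP]] :=
    infinite_setN0 (infinite_setD I_infinite (finite_II (maxn n N))).
  rewrite /= -leqNgt geq_max => /andP[ni Ni]; exists i => //.
  have d0 := quotient_gt0R R g adic_g i.
  have : (adic_quotient g i)%:R^-1 < (`|M| + 1)^-1.
    apply: le_lt_trans (smallN i Ni).
    exact: quotient_inv_le_excluded_ratio (U_nonempty _ Ii).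
  rewrite ltf_pV2 ?posrE// ?ltr_wpDl// => lt.
  apply: le_trans (ler_norm M) (ltW _).
  by apply: le_lt_trans lt; rewrite lerDl.
have [N tailN] : exists N,
    forall m, \sum_(N <= i < m) excluded_ratio R g I U i < 4^-1.
  by apply: tail; rewrite invr_gt0.
have c0 : 0 < 8^-1 * allowed_density R g I U N.
  by rewrite mulr_gt0 ?invr_gt0 ?allowed_density_gt0.
set c := 8^-1 * _ in c0.
have inv0 a : a \in missing_digits g I U -> (0 <= ((a%:R : R)^-1)%:E)%E.
  by rewrite lee_fin invr_ge0.
rewrite -[X in esum X _]set_mem_set -nneseries_esum//.
apply: eq_infty => t.
pose m := Num.bound `|t / c|.
apply: (@le_trans _ _ (harmonic_sum R g I U (g (N + m)%N))%:E).
  rewrite lee_fin; apply: (@le_trans _ _ (m%:R * c)); last first.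
    exact: harmonic_sum_growth.
  rewrite -ler_pdivrMr//; apply: le_trans (ler_norm _) _.
  apply: ltW; exact: archi_boundP.
rewrite -sumEFin; apply: nneseries_lim_ge => a _; exact: inv0.
Qed.
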